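(* Let $\mathcal F=\mathbb C[[\varepsilon]]\langle\mathbf x,\mathbf y\rangle$ and let $\mathbf C_{\mathbf x\mathbf y}\in\mathcal F$ be any element. Then the quotient algebra $\mathcal A=\mathcal F/\{[\mathbf x,\mathbf y]=\varepsilon\mathbf C_{\mathbf x\mathbf y}\}$ is a deformation quantization of $\mathbb R^2$ (that is, of $\mathbb C[x,y]$).
   Context: $\mathcal F=\mathbb C[[\varepsilon]]\langle\mathbf x,\mathbf y\rangle$ is the algebra of formal series $\sum_{r\ge0}\varepsilon^r\mathbf a_r$ with $\mathbf a_r$ in the free associative unital noncommutative algebra $\mathbb C\langle\mathbf x,\mathbf y\rangle$, with product $(\sum_r\varepsilon^r\mathbf a_r)(\sum_s\varepsilon^s\mathbf b_s)=\sum_{r,s}\varepsilon^{r+s}\mathbf a_r\mathbf b_s$; $\varepsilon$ is central. $[\mathbf f,\mathbf g]=\mathbf f\mathbf g-\mathbf g\mathbf f$. There is a surjective homomorphism $\pi_{\mathcal F}:\mathcal F\to\mathbb C[x,y]$ with $\pi_{\mathcal F}(\varepsilon)=0$, $\pi_{\mathcal F}(\mathbf x)=x$, $\pi_{\mathcal F}(\mathbf y)=y$ (it kills $\varepsilon\mathcal F$). $\psi_{\mathcal F}:\mathcal F\to\mathcal A$ is the quotient homomorphism of $\mathcal F$ by the relation $[\mathbf x,\mathbf y]=\varepsilon\mathbf C_{\mathbf x\mathbf y}$, i.e. by the two-sided ideal generated by $[\mathbf x,\mathbf y]-\varepsilon\mathbf C_{\mathbf x\mathbf y}$. $\mathcal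 A$ is a deformation quantization of $\mathbb R^2$ (of $\mathbb C[x,y]$) if there is a (surjective) homomorphism of $\mathbb C$-algebras $\pi:\mathcal A\to\mathbb C[x,y]$ with $\pi(\varepsilon)=0$, $\pi(\mathbf x)=x$, $\pi(\mathbf y)=y$, such that $\pi\circ\psi_{\mathcal F}=\pi_{\mathcal F}$, and if moreover $\mathcal A$ has the property: $\mathbf f\in\mathcal A$, $\varepsilon\mathbf f=0$ implies $\mathbf f=0$. *)

(* Defs.v *)
From HB Require Import structures.
From mathcomp Require Import all_boot all_algebra.
From mathcomp Require Import boolp reals complex.
From mathcomp Require Import monalg mpoly.

Set Implicit Arguments.
Unset Strict Implicit.
Unset Printing Implicit Defensive.

Import GRing.Theory.
Local Open Scope ring_scope.
Local Open Scope quotient_scope.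

(* monalg and mpoly both define this notation; it denotes the type of mpoly. *)
Notation "{ 'mpoly' T [ n ] }" := (mpoly.mpoly n T) : type_scope.

Section FreeAlgebra.
Variable K : comNzRingType.

(* Words in the letters ord0 (standing for x) and ord_max (standing for y),
   with concatenation as product. *)
Definition free_alg : Type := {malg K[{fmonom 'I_2}]}.

HB.instance Definition _ := GRing.Lalgebra.on free_alg.

Lemma free_alg_scaleAr (k : K) (a b : free_alg) : k *: (a * b) = a * (k *: b).
Proof.
apply/malgP => w.
rewrite monalg.mcoeffZ !monalg.mcoeffMl mulr_sumr; apply: eq_bigr => u _.
rewrite mulr_sumr (finmap.big_fset_incl _ (monalg.msuppZ_le k b)) /=.
  by apply: eq_bigr => v _; rewrite monalg.mcoeffZ mulrnAr mulrCA.
by move=> v _ /monalg.mcoeff_outdom ->; rewrite mulr0 mul0rn.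
Qed.

HB.instance Definition _ := GRing.Lalgebra_isAlgebra.Build K free_alg
  free_alg_scaleAr.

Definition word_eval (w : {fmonom 'I_2}) : {mpoly K[2]} :=
  \prod_(i <- w) 'X_i.

Lemma word_eval_morphism : mmorphism word_eval.
Proof.
split=> [u v|]; rewrite /word_eval.
  by rewrite /mmul /= fmmulE /= big_cat.
by rewrite /mone /= fmoneE /= big_nil.
Qed.

HB.instance Definition _ :=
  isMultiplicative.Build {fmonom 'I_2} {mpoly K[2]} word_eval
    word_eval_morphism.

Definition abelianize (a : free_alg) : {mpoly K[2]} :=
  monalg.mmap (@mpolyC 2 K) word_eval a.

HB.instance Definition _ := GRing.RMorphism.copy abelianize
  (monalg.mmap (@mpolyC 2 K) word_eval).

Lemma abelianize_scalable : scalable abelianize.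
Proof. by move=> k a; rewrite /abelianize monalg.mmapZ mul_mpolyC. Qed.

HB.instance Definition _ :=
  GRing.isScalable.Build K free_alg {mpoly K[2]} *:%R abelianize
    abelianize_scalable.

End FreeAlgebra.

(* fps A is A[[eps]] with eps central; coef f r is the coefficient of eps^r. *)
Record fps (A : Type) : Type := Fps { coef : nat -> A }.

(* Locked so that unification does not unfold products of series. *)
HB.lock Definition fps_mul (A : nzRingType) (f g : fps A) : fps A :=
  Fps (fun n => \sum_(i < n.+1) coef f i * coef g (n - i)%N).
Arguments fps_mul {A} f g.

Section FpsRing.
Variable A : nzRingType.
Implicit Types f g h : fps A.

HB.instance Definition _ := [isNew for @coef A].
HB.instance Definition _ := [Choice of fps A by <:].

Lemma fpsP f g : (forall n, coef f n = coef g n) -> f = g.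
Proof. by move=> fg; apply: val_inj; apply/funext. Qed.

Definition fps_zero : fps A := Fps (fun=> 0).
Definition fps_opp f : fps A := Fps (fun n => - coef f n).
Definition fps_add f g : fps A := Fps (fun n => coef f n + coef g n).

Lemma fps_addA : associative fps_add.
Proof. by move=> f g h; apply: fpsP => n /=; rewrite addrA. Qed.
Lemma fps_addC : commutative fps_add.
Proof. by move=> f g; apply: fpsP => n /=; rewrite addrC. Qed.
Lemma fps_add0 : left_id fps_zero fps_add.
Proof. by move=> f; apply: fpsP => n /=; rewrite add0r. Qed.
Lemma fps_addN : left_inverse fps_zero fps_opp fps_add.
Proof. by move=> f; apply: fpsP => n /=; rewrite addNr. Qed.

HB.instance Definition _ :=
  GRing.isZmodule.Build (fps A) fps_addA fps_addC fps_add0 fps_addN.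

Definition fps_const (a : A) : fps A :=
  Fps (fun n => if n is 0%N then a else 0).

Lemma coef_fps_mul f g n :
  coef (fps_mul f g) n = \sum_(i < n.+1) coef f i * coef g (n - i)%N.
Proof. by rewrite fps_mul.unlock. Qed.

Lemma coef_fps_mul_rev f g n :
  coef (fps_mul f g) n = \sum_(i < n.+1) coef f (n - i)%N * coef g i.
Proof.
rewrite coef_fps_mul (reindex_inj rev_ord_inj) /=.
by apply: eq_bigr => i _; rewrite (sub_ordK i).
Qed.

Lemma fps_mulA : associative (@fps_mul A).
Proof.
move=> p q r; apply: fpsP => i; rewrite [RHS]coef_fps_mul_rev coef_fps_mul.
pose coef3 j k := coef p j * (coef q (i - j - k)%N * coef r k).
transitivity (\sum_(j < i.+1) \sum_(k < i.+1 | (k <= i - j)%N) coef3 j k).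
  apply: eq_bigr => j _; rewrite coef_fps_mul_rev big_distrr.
  by rewrite (big_ord_narrow_leq (leq_subr _ _)).
rewrite (exchange_big_dep predT) //; apply: eq_bigr => k _.
transitivity (\sum_(j < i.+1 | (j <= i - k)%N) coef3 j k).
  apply: eq_bigl => j; rewrite -ltnS -(ltnS j) -!subSn ?leq_ord //.
  by rewrite -subn_gt0 -(subn_gt0 j) -!subnDA addnC.
rewrite (big_ord_narrow_leq (leq_subr _ _)) coef_fps_mul big_distrl /=.
by apply: eq_bigr => j _; rewrite /coef3 -!subnDA addnC mulrA.
Qed.

Lemma fps_mul1l : left_id (fps_const 1) (@fps_mul A).
Proof.
move=> f; apply: fpsP => n; rewrite coef_fps_mul big_ord_recl /= mul1r subn0.
by rewrite big1 ?addr0 // => i _; rewrite mul0r.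
Qed.

Lemma fps_mul1r : right_id (fps_const 1) (@fps_mul A).
Proof.
move=> f; apply: fpsP => n; rewrite coef_fps_mul_rev big_ord_recl /= mulr1.
by rewrite subn0 big1 ?addr0 // => i _; rewrite mulr0.
Qed.

Lemma fps_mulDl : left_distributive (@fps_mul A) +%R.
Proof.
move=> f g h; apply: fpsP => n.
rewrite /= !coef_fps_mul -big_split.
by apply: eq_bigr => i _; rewrite /= mulrDl.
Qed.

Lemma fps_mulDr : right_distributive (@fps_mul A) +%R.
Proof.
move=> f g h; apply: fpsP => n.
rewrite /= !coef_fps_mul -big_split.
by apply: eq_bigr => i _; rewrite /= mulrDr.
Qed.

Lemma fps_one_neq0 : fps_const 1 != 0.
Proof. by apply/eqP => /(congr1 (fun f => coef f 0%N)) /eqP; rewrite /= oner_eq0. Qed.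

HB.instance Definition _ := GRing.Zmodule_isNzRing.Build (fps A)
  fps_mulA fps_mul1l fps_mul1r fps_mulDl fps_mulDr fps_one_neq0.

Lemma coef_mul f g n :
  coef (f * g) n = \sum_(i < n.+1) coef f i * coef g (n - i)%N.
Proof. exact: coef_fps_mul. Qed.

Definition fps_eps : fps A := Fps (fun n => (n == 1%N)%:R).

End FpsRing.

Arguments fps_eps {A}.

Section FpsAlgebra.
Variables (K : comNzRingType) (A : algType K).
Implicit Types (k l : K) (f g : fps A).

Definition fps_scale k f : fps A := Fps (fun n => k *: coef f n).

Lemma fps_scaleA k l f : fps_scale k (fps_scale l f) = fps_scale (k * l) f.
Proof. by apply: fpsP => n /=; rewrite scalerA. Qed.
Lemma fps_scale1 : left_id 1 fps_scale.
Proof. by move=> f; apply: fpsP => n /=; rewrite scale1r. Qed.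
Lemma fps_scaleDr : right_distributive fps_scale +%R.
Proof. by move=> k f g; apply: fpsP => n /=; rewrite scalerDr. Qed.
Lemma fps_scaleDl f : {morph fps_scale^~ f : k l / k + l}.
Proof. by move=> k l; apply: fpsP => n /=; rewrite scalerDl. Qed.

HB.instance Definition _ := GRing.Zmodule_isLmodule.Build K (fps A)
  fps_scaleA fps_scale1 fps_scaleDr fps_scaleDl.

Lemma fps_scaleAl k f g : k *: (f * g) = (k *: f) * g.
Proof.
apply: fpsP => n; rewrite /= !coef_mul scaler_sumr.
by apply: eq_bigr => i _; rewrite scalerAl.
Qed.

HB.instance Definition _ := GRing.Lmodule_isLalgebra.Build K (fps A) fps_scaleAl.

Lemma fps_scaleAr k f g : k *: (f * g) = f * (k *: g).
Proof.
apply: fpsP => n; rewrite /= !coef_mul scaler_sumr.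
by apply: eq_bigr => i _; rewrite scalerAr.
Qed.

HB.instance Definition _ := GRing.Lalgebra_isAlgebra.Build K (fps A) fps_scaleAr.

End FpsAlgebra.

Section TwoSidedIdeal.
Variables (A : nzRingType) (r : A).

Definition ideal_gen : {pred A} := fun f =>
  `[< exists s : seq (A * A), f = \sum_(p <- s) p.1 * r * p.2 >].

Lemma ideal_genP f :
  reflect (exists s : seq (A * A), f = \sum_(p <- s) p.1 * r * p.2)
          (f \in ideal_gen).
Proof. exact: asboolP. Qed.

Lemma ideal_gen_closed : zmod_closed ideal_gen.
Proof.
split=> [|_ _ /ideal_genP[s ->] /ideal_genP[t ->]]; apply/ideal_genP.
  by exists [::]; rewrite big_nil.
exists (s ++ [seq (- p.1, p.2) | p <- t]); rewrite big_cat big_map /= -sumrN.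
by congr (_ + _); apply: eq_bigr => p _; rewrite !mulNr.
Qed.

HB.instance Definition _ := GRing.isZmodClosed.Build A ideal_gen
  ideal_gen_closed.

Lemma ideal_genMl a f : f \in ideal_gen -> a * f \in ideal_gen.
Proof.
case/ideal_genP=> s ->; apply/ideal_genP; exists [seq (a * p.1, p.2) | p <- s].
by rewrite big_map mulr_sumr; apply: eq_bigr => p _; rewrite !mulrA.
Qed.

Lemma ideal_genMr a f : f \in ideal_gen -> f * a \in ideal_gen.
Proof.
case/ideal_genP=> s ->; apply/ideal_genP; exists [seq (p.1, p.2 * a) | p <- s].
by rewrite big_map mulr_suml; apply: eq_bigr => p _; rewrite !mulrA.
Qed.

End TwoSidedIdeal.

Section FormalAlgebra.
Variable K : comNzRingType.

Definition formal_alg : Type := fps (free_alg K).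
HB.instance Definition _ := GRing.Algebra.on formal_alg.

Definition fX : formal_alg := fps_const (<< fmu ord0 >> : free_alg K).
Definition fY : formal_alg := fps_const (<< fmu ord_max >> : free_alg K).
Definition feps : formal_alg := fps_eps.

Definition piF (f : formal_alg) : {mpoly K[2]} := abelianize (coef f 0%N).

Lemma piF_zmod_morphism : zmod_morphism piF.
Proof. by move=> f g; rewrite /piF /= raddfB. Qed.
HB.instance Definition _ := GRing.isZmodMorphism.Build formal_alg {mpoly K[2]} piF
  piF_zmod_morphism.

Lemma piF_monoid_morphism : monoid_morphism piF.
Proof.
split=> [|f g]; rewrite /piF /=; first by rewrite rmorph1.
by rewrite coef_mul big_ord1 rmorphM.
Qed.
HB.instance Definition _ := GRing.isMonoidMorphism.Build formal_alg {mpoly K[2]} piF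
  piF_monoid_morphism.

Lemma piF_scalable : scalable piF.
Proof. by move=> k f; rewrite /piF /= linearZ. Qed.
HB.instance Definition _ := GRing.isScalable.Build K formal_alg {mpoly K[2]} *:%R piF
  piF_scalable.

Lemma piF_eps : piF feps = 0.
Proof. by rewrite /piF /= raddf0. Qed.

Lemma piF_X : piF fX = 'X_ord0.
Proof.
by rewrite /piF /= /abelianize monalg.mmapU /= mpolyC1 mul1r /word_eval fmuE big_seq1.
Qed.

Lemma piF_Y : piF fY = 'X_ord_max.
Proof.
by rewrite /piF /= /abelianize monalg.mmapU /= mpolyC1 mul1r /word_eval fmuE big_seq1.
Qed.

Variable Cxy : formal_alg.

Definition defining_relation : formal_alg := fX * fY - fY * fX - feps * Cxy.

Local Notation I := (ideal_gen defining_relation).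

Lemma piF_commutator (f g h k : formal_alg) :
  piF h = 0 -> piF (f * g - g * f - h * k) = 0.
Proof.
move=> h0; rewrite 2!raddfB /= !rmorphM /= h0 mul0r subr0.
by rewrite [X in X - _]mulrC subrr.
Qed.

Lemma piF_sandwich (f g h : formal_alg) : piF g = 0 -> piF (f * g * h) = 0.
Proof. by move=> g0; rewrite !rmorphM /= g0 mulr0 mul0r. Qed.

Lemma piF_ideal f : f \in I -> piF f = 0.
Proof.
case/ideal_genP=> s ->; rewrite raddf_sum big1 // => p _.
exact/piF_sandwich/piF_commutator/piF_eps.
Qed.

Lemma ideal_proper : 1 \notin I.
Proof. by apply/negP => /piF_ideal /eqP; rewrite rmorph1 oner_eq0. Qed.

(* The underlying abelian group of the quotient is the library's; the product
   and the scalar multiplication are the induced ones. *)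
Definition quot_alg : Type := Quotient.quot I.
HB.instance Definition _ := GRing.Zmodule.on quot_alg.
HB.instance Definition _ := EqQuotient.on quot_alg.

Definition psiF (f : formal_alg) : quot_alg := \pi_quot_alg f.

Lemma psiF_eq f g : psiF f = psiF g <-> f - g \in I.
Proof. by rewrite Quotient.idealrBE; split=> /eqP. Qed.

Lemma psiF_surj (q : quot_alg) : exists f, psiF f = q.
Proof. by exists (repr q); rewrite /psiF reprK. Qed.

Lemma psiF_zmod_morphism : zmod_morphism psiF.
Proof. by move=> f g; rewrite /psiF !piE. Qed.
HB.instance Definition _ := GRing.isZmodMorphism.Build formal_alg quot_alg psiF
  psiF_zmod_morphism.

Definition quot_one : quot_alg := psiF 1.
Definition quot_mul (p q : quot_alg) : quot_alg := psiF (repr p * repr q).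
Definition quot_scale (k : K) (q : quot_alg) : quot_alg := psiF (k *: repr q).

Lemma psiF_repr (q : quot_alg) : psiF (repr q) = q.
Proof. exact: reprK. Qed.

Lemma repr_psiF f : repr (psiF f) - f \in I.
Proof. by apply/psiF_eq; rewrite psiF_repr. Qed.

Lemma psiF_mul f g : quot_mul (psiF f) (psiF g) = psiF (f * g).
Proof.
apply/psiF_eq.
rewrite -[X in X - _](subrK (f * repr (psiF g))) -mulrBl -addrA -mulrBr.
by apply: rpredD; [apply: ideal_genMr|apply: ideal_genMl]; exact: repr_psiF.
Qed.

Lemma psiF_scale k f : quot_scale k (psiF f) = psiF (k *: f).
Proof. by apply/psiF_eq; rewrite -scalerBr -mulr_algl ideal_genMl ?repr_psiF. Qed.

Lemma quot_mulA : associative quot_mul.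
Proof.
move=> p q r; have [[f <-] [g <-]] := (psiF_surj p, psiF_surj q).
by have [h <-] := psiF_surj r; rewrite !psiF_mul mulrA.
Qed.

Lemma quot_mul1l : left_id quot_one quot_mul.
Proof. by move=> q; have [f <-] := psiF_surj q; rewrite psiF_mul mul1r. Qed.

Lemma quot_mul1r : right_id quot_one quot_mul.
Proof. by move=> q; have [f <-] := psiF_surj q; rewrite psiF_mul mulr1. Qed.

Lemma quot_mulDl : left_distributive quot_mul +%R.
Proof.
move=> p q r; have [[f <-] [g <-]] := (psiF_surj p, psiF_surj q).
have [h <-] := psiF_surj r.
by rewrite -raddfD !psiF_mul -raddfD mulrDl.
Qed.

Lemma quot_mulDr : right_distributive quot_mul +%R.
Proof.
move=> p q r; have [[f <-] [g <-]] := (psiF_surj p, psiF_surj q).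
have [h <-] := psiF_surj r.
by rewrite -raddfD !psiF_mul -raddfD mulrDr.
Qed.

Lemma quot_one_neq0 : quot_one != 0.
Proof.
apply/eqP; rewrite /quot_one -(raddf0 psiF) => /psiF_eq.
by rewrite subr0; apply/negP/ideal_proper.
Qed.

HB.instance Definition _ := GRing.Zmodule_isNzRing.Build quot_alg
  quot_mulA quot_mul1l quot_mul1r quot_mulDl quot_mulDr quot_one_neq0.

Lemma quot_scaleA k l q : quot_scale k (quot_scale l q) = quot_scale (k * l) q.
Proof. by have [f <-] := psiF_surj q; rewrite !psiF_scale scalerA. Qed.

Lemma quot_scale1 : left_id 1 quot_scale.
Proof. by move=> q; have [f <-] := psiF_surj q; rewrite psiF_scale scale1r. Qed.

Lemma quot_scaleDr : right_distributive quot_scale +%R.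
Proof.
move=> k p q; have [[f <-] [g <-]] := (psiF_surj p, psiF_surj q).
by rewrite -raddfD !psiF_scale -raddfD scalerDr.
Qed.

Lemma quot_scaleDl q : {morph quot_scale^~ q : k l / k + l}.
Proof.
by move=> k l; have [f <-] := psiF_surj q; rewrite !psiF_scale -raddfD scalerDl.
Qed.

HB.instance Definition _ := GRing.Zmodule_isLmodule.Build K quot_alg
  quot_scaleA quot_scale1 quot_scaleDr quot_scaleDl.

Lemma quot_scaleAl k (p q : quot_alg) : k *: (p * q) = (k *: p) * q.
Proof.
have [[f <-] [g <-]] := (psiF_surj p, psiF_surj q).
by rewrite /GRing.scale /GRing.mul /= !(psiF_mul, psiF_scale) scalerAl.
Qed.

HB.instance Definition _ := GRing.Lmodule_isLalgebra.Build K quot_alg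
  quot_scaleAl.

Lemma quot_scaleAr k (p q : quot_alg) : k *: (p * q) = p * (k *: q).
Proof.
have [[f <-] [g <-]] := (psiF_surj p, psiF_surj q).
by rewrite /GRing.scale /GRing.mul /= !(psiF_mul, psiF_scale) scalerAr.
Qed.

HB.instance Definition _ := GRing.Lalgebra_isAlgebra.Build K quot_alg
  quot_scaleAr.

Lemma psiF_monoid_morphism : monoid_morphism psiF.
Proof. by split=> // f g; rewrite -psiF_mul. Qed.
HB.instance Definition _ := GRing.isMonoidMorphism.Build formal_alg quot_alg psiF
  psiF_monoid_morphism.

Lemma psiF_scalable : scalable psiF.
Proof. by move=> k f; rewrite -psiF_scale. Qed.
HB.instance Definition _ := GRing.isScalable.Build K formal_alg quot_alg *:%R psiF
  psiF_scalable.

End FormalAlgebra.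

(* The elements eps, x, y of A are the images of feps, fX, fY under psi. *)
Definition deformation_quantization (K : comNzRingType) (A : algType K)
    (psi : {lrmorphism formal_alg K -> A}) : Prop :=
  (exists pi : {lrmorphism A -> {mpoly K[2]}},
     [/\ forall p, exists f, pi f = p,
         pi (psi (feps K)) = 0,
         pi (psi (fX K)) = 'X_ord0,
         pi (psi (fY K)) = 'X_ord_max
       & forall f, pi (psi f) = piF f]) /\
  (forall f : A, psi (feps K) * f = 0 -> f = 0).

(* Main.v *)
(* Let r = [x, y] - eps C and I = (r). Torsion-freeness of A says that
   eps f \in I implies f \in I. Rewriting y x to x y turns each word w into an
   ordered monomial; the terms u r v collected on the way add up to S(w) \in I,
   and S(w) = w - x^a y^b modulo eps. Hence S, extended linearly, satisfies
   S(a [x, y] b) = a r b modulo eps I for all noncommutative polynomials a, b.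
   If eps f = sum_i p_i r q_i, then the constant terms a_i, b_i of p_i, q_i
   satisfy sum_i a_i [x, y] b_i = 0; applying S gives sum_i a_i r b_i \in eps I,
   so eps f \in eps I, and eps is a nonzerodivisor. *)

Require Import Defs.
From HB Require Import structures.
From mathcomp Require Import all_boot all_algebra.
From mathcomp Require Import reals complex.
From mathcomp Require Import boolp monalg mpoly.

Set Implicit Arguments.
Unset Strict Implicit.
Unset Printing Implicit Defensive.

Import GRing.Theory.
Local Open Scope ring_scope.

(* monalg and mpoly both define this notation; it denotes the type of mpoly. *)
Local Notation "{ 'mpoly' T [ n ] }" := (mpoly.mpoly n T) : type_scope.

(** * The multiple [e * (r)] of a principal two-sided ideal by a central element *)

Section CentralMultiple.
Variables (F : nzRingType) (e r : F).
Hypothesis e_central : forall f, f * e = e * f.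

Definition central_ideal : {pred F} :=
  fun f => `[< exists2 g, g \in ideal_gen r & f = e * g >].

Lemma central_idealP f :
  reflect (exists2 g, g \in ideal_gen r & f = e * g) (f \in central_ideal).
Proof. exact: asboolP. Qed.

Lemma central_ideal_closed : zmod_closed central_ideal.
Proof.
split=> [|_ _ /central_idealP[f If ->] /central_idealP[g Ig ->]].
  by apply/central_idealP; exists 0; rewrite ?rpred0 ?mulr0.
by apply/central_idealP; exists (f - g); rewrite ?rpredB ?mulrBr.
Qed.

HB.instance Definition _ :=
  GRing.isZmodClosed.Build F central_ideal central_ideal_closed.

Lemma central_idealI f : f \in ideal_gen r -> e * f \in central_ideal.
Proof. by move=> If; apply/central_idealP; exists f. Qed.

Lemma central_idealMl f g : g \in central_ideal -> f * g \in central_ideal.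
Proof.
case/central_idealP=> h Ih ->; rewrite mulrA e_central -mulrA.
exact/central_idealI/ideal_genMl.
Qed.

Lemma mem_ideal_gen : r \in ideal_gen r.
Proof. by apply/ideal_genP; exists [:: (1, 1)]; rewrite big_seq1 mul1r mulr1. Qed.

(** As [e] is central, it can be pulled out of every term containing [f'] or [g'], and the cofactor
    still contains [r]. *)
Lemma central_ideal_sandwich f f' g g' :
  (f + e * f') * r * (g + e * g') - f * r * g \in central_ideal.
Proof.
have -> : (f + e * f') * r * (g + e * g') - f * r * g =
    e * (f * r * g' + f' * r * (g + e * g')).
  rewrite [e * (_ + _)]mulrDr !mulrDl [f * r * (_ + _)]mulrDr addrAC.
  rewrite [f * r * g + _ - _]addrAC subrr add0r; congr (_ + _).
    by rewrite mulrA e_central -mulrA.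
  by rewrite !mulrA.
apply: central_idealI.
by rewrite rpredD // ideal_genMr // ideal_genMl // mem_ideal_gen.
Qed.

End CentralMultiple.

(** * Straightening words under the commutation relation *)

Section Straightening.
Variables (F : nzRingType) (x y e r C : F).
Hypothesis e_central : forall f, f * e = e * f.
Hypothesis commutatorE : x * y - y * x = r + e * C.

Local Notation I := (ideal_gen r).

Definition letter (i : 'I_2) : F := if i == ord0 then x else y.
Definition word (w : seq 'I_2) : F := \prod_(i <- w) letter i.

Local Notation nx := (count_mem (ord0 : 'I_2)).
Local Notation ny := (count (predC1 (ord0 : 'I_2))).

(** The commutator of [x ^+ a] with [y] expanded by the Leibniz rule, with [r] in place of [[x, y]]:
    the sum of [x ^+ i * r * x ^+ (a - 1 - i)] over [i < a]. *)
Fixpoint move_left (a : nat) : F :=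
  if a is a'.+1 then r * x ^+ a' + x * move_left a' else 0.

(* Rewriting [y x] to [x y] from the right turns a word [w] into
   [x ^+ nx w * y ^+ ny w]; this sums the terms [u * r * v] over the steps. *)
Fixpoint straighten (w : seq 'I_2) : F :=
  if w is i :: w' then
    if i == ord0 then x * straighten w'
    else y * straighten w' - move_left (nx w') * y ^+ ny w'
  else 0.

Lemma move_left_ideal a : move_left a \in I.
Proof.
elim: a => [|a IHa] /=; first exact: rpred0.
by rewrite rpredD ?(ideal_genMl _ IHa) ?ideal_genMr ?mem_ideal_gen.
Qed.

Lemma straighten_ideal w : straighten w \in I.
Proof.
elim: w => [|i w IHw] /=; first exact: rpred0.
case: ifP => _; rewrite ?rpredB ?(ideal_genMl _ IHw) //.
by rewrite ideal_genMr ?move_left_ideal.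
Qed.

Lemma move_leftE a : exists d, x ^+ a * y - y * x ^+ a = move_left a + e * d.
Proof.
elim: a => [|a [d IHa]] /=.
  by exists 0; rewrite expr0 mul1r mulr1 subrr mulr0 addr0.
exists (C * x ^+ a + x * d).
have -> : x ^+ a.+1 * y - y * x ^+ a.+1 =
    (x * y - y * x) * x ^+ a + x * (x ^+ a * y - y * x ^+ a).
  by rewrite exprS mulrBl mulrBr !mulrA [RHS]addrC subrKA.
by rewrite IHa commutatorE mulrDl !mulrDr !mulrA e_central addrACA.
Qed.

(** The rewriting steps telescope to the word minus its ordered monomial; replacing [[x, y]] by [r]
    in each step costs a multiple of [e], gathered in [d]. *)
Lemma straightenE w :
  exists d, straighten w = word w - x ^+ nx w * y ^+ ny w - e * d.
Proof.
rewrite /word; elim: w => [|i w [d IHw]] /=.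
  by exists 0; rewrite big_nil mul1r subrr mulr0 subrr.
rewrite big_cons /letter; case: eqP => _ /=.
  by exists (x * d); rewrite IHw !mulrBr exprS !mulrA e_central.
have [d' ad'] := move_leftE (nx w).
exists (y * d - d' * y ^+ ny w).
have -> : move_left (nx w) = x ^+ nx w * y - y * x ^+ nx w - e * d'.
  by rewrite ad' addrK.
have cancelQ p q s t z : p - q - t - (s - q - z) = p - s - (t - z) :> F.
  by rewrite opprD addrACA -opprD [- (s - q)]opprB subrKA.
rewrite IHw exprS !(mulrBl, mulrBr) !mulrA -[e * y]e_central.
by rewrite cancelQ.
Qed.

Lemma straighten_swap u v :
  straighten (u ++ [:: ord0, ord_max & v]) -
    straighten (u ++ [:: ord_max, ord0 & v]) - word u * r * word v
  \in central_ideal e r.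
Proof.
elim: u => [|i u IHu].
  rewrite [word [::]]big_nil mul1r /= !add0n.
  have [d vd] := straightenE v.
  (* The second word has one more [x] to cross; unfolding [move_left] once leaves a single new term
     in [r]. *)
  have -> : x * (y * straighten v - move_left (nx v) * y ^+ ny v)
     - (y * (x * straighten v) - (r * x ^+ nx v + x * move_left (nx v)) * y ^+ ny v)
     = (x * y - y * x) * straighten v + r * (x ^+ nx v * y ^+ ny v).
    by rewrite mulrBr mulrBl mulrDl !mulrA opprB addrA [r * _ * _ + _]addrC subrKA addrAC.
  have vdE : straighten v + x ^+ nx v * y ^+ ny v = word v - e * d.
    by rewrite vd addrAC subrK.
  rewrite commutatorE mulrDl [_ + _ + r * _]addrAC -mulrDr vdE mulrBr.
  rewrite addrAC [_ - _ - _]addrAC subrr sub0r rpredD ?rpredN //.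
    by rewrite mulrA e_central -mulrA central_idealI ?ideal_genMr ?mem_ideal_gen.
  (* The error [e * C * straighten v] lies in [e * I], not just in [e * F], because [straighten v]
     is in [I]. *)
  by rewrite -mulrA central_idealI ?ideal_genMl ?straighten_ideal.
have wordE w : word (i :: w) = letter i * word w by rewrite /word big_cons.
rewrite wordE /letter /= !count_cat /=; case: eqP => _ /=.
  by rewrite -!mulrA -!mulrBr mulrA central_idealMl.
(* The two words have equal letter counts, so their [move_left] corrections cancel. *)
rewrite opprB addrA subrK -!mulrA -!mulrBr mulrA.
exact: central_idealMl.
Qed.

End Straightening.

Lemma sandwich_commutator (A : nzRingType) (a b x y : A) :
  a * (x * y - y * x) * b = a * x * y * b - a * y * x * b.
Proof. by rewrite mulrBr mulrBl !mulrA. Qed.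

Lemma scale_sandwich (K : comNzRingType) (A : algType K) k l (a b c : A) :
  (k *: a) * b * (l *: c) = (k * l) *: (a * b * c).
Proof. by rewrite -!scalerAl -scalerAr scalerA. Qed.

(** * From words to arbitrary elements by bilinearity *)

Section SandwichDefect.
Variables (K : comNzRingType) (A F : algType K) (T : Type) (word : T -> A).
Hypothesis span_ind : forall P : A -> Prop,
  P 0 -> (forall a b, P a -> P b -> P (a + b)) ->
  (forall k t, P (k *: word t)) -> forall a, P a.
Variables (S iota : {additive A -> F}) (s : T -> F) (c : A) (r : F).
Variable J : zmodClosed F.
Hypothesis SE : forall k t, S (k *: word t) = k *: s t.
Hypothesis iotaZ : scalable iota.
Hypothesis J_mul : forall f g, g \in J -> f * g \in J.
Hypothesis J_word : forall u v,
  S (word u * c * word v) - iota (word u) * r * iota (word v) \in J.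

Lemma sandwich_defect a b : S (a * c * b) - iota a * r * iota b \in J.
Proof.
have SZ k a' : S (k *: a') = k *: S a'.
  elim/span_ind: a' => [|a1 a2 IH1 IH2|l t]; first by rewrite !(scaler0, raddf0).
    by rewrite scalerDr !raddfD IH1 IH2.
  by rewrite scalerA !SE scalerA.
have JD (f g f' g' : F) :
    f - g \in J -> f' - g' \in J -> f + f' - (g + g') \in J.
  by move=> ? ?; rewrite opprD addrACA rpredD.
elim/span_ind: a => [|a a' IHa IHa'|k u].
- by rewrite !mul0r !raddf0 !mul0r subrr rpred0.
- by rewrite !mulrDl !raddfD !mulrDl JD.
elim/span_ind: b => [|b b' IHb IHb'|l v].
- by rewrite !mulr0 !raddf0 !mulr0 subrr rpred0.
- by rewrite [_ * (b + b')]mulrDr !raddfD [_ * (iota b + _)]mulrDr JD.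
(* The scalar [k * l] becomes a left factor in [F], which [J] absorbs. *)
rewrite scale_sandwich SZ !iotaZ scale_sandwich -scalerBr -mulr_algl.
exact/J_mul/J_word.
Qed.

End SandwichDefect.

(* Locked so that unification does not unfold monomials. *)
HB.lock Definition free_word (K : comNzRingType) (w : {fmonom 'I_2}) :
  free_alg K := << w >>.
Arguments free_word {K} w.

(** * Multiplication by eps and constant series *)

Section Deformation.
Variables (K : comNzRingType) (Cxy : formal_alg K).
Local Notation F := (formal_alg K).
Local Notation r := (defining_relation Cxy).
Local Notation I := (ideal_gen r).
Local Notation eI := (central_ideal (feps K) r).
Local Notation const := (@fps_const (free_alg K)).

Lemma coef_epsM (f : F) n :
  coef (feps K * f) n = if n is m.+1 then coef f m else 0.
Proof.
rewrite coef_mul /=; case: n => [|n]; first by rewrite big_ord1 mul0r.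
rewrite 2!big_ord_recl /= mul0r add0r mul1r subSS subn0 big1 ?addr0 // => i _.
by rewrite mul0r.
Qed.

Lemma coef_mul_eps (f : F) n :
  coef (f * feps K) n = if n is m.+1 then coef f m else 0.
Proof.
rewrite [coef _ _]coef_fps_mul_rev /=; case: n => [|n].
  by rewrite big_ord1 mulr0.
rewrite 2!big_ord_recl /= mulr0 add0r mulr1 subSS subn0 big1 ?addr0 // => i _.
by rewrite mulr0.
Qed.

Lemma eps_central (f : F) : f * feps K = feps K * f.
Proof. by apply: fpsP => n; rewrite coef_epsM coef_mul_eps. Qed.

Lemma eps_regular (f g : F) : feps K * f = feps K * g -> f = g.
Proof.
by move=> fg; apply: fpsP => n; rewrite -(coef_epsM f n.+1) fg coef_epsM.
Qed.

Lemma const_shift (f : F) :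
  f = const (coef f 0) + feps K * (Fps (fun n => coef f n.+1) : F).
Proof.
apply: fpsP => -[|n]; rewrite [RHS]/= coef_epsM ?addr0 ?add0r //.
Qed.

Lemma constM (a b : free_alg K) : const (a * b) = (const a : F) * const b.
Proof.
apply: fpsP => -[|n]; rewrite coef_mul /=; first by rewrite big_ord1.
by rewrite big1 // => -[[|i] ?] _ /=; rewrite ?mulr0 ?mul0r.
Qed.

Lemma const_additive : zmod_morphism const.
Proof. by move=> a b; apply: fpsP => -[|n] //=; rewrite subr0. Qed.
HB.instance Definition _ := GRing.isZmodMorphism.Build (free_alg K) F
  const const_additive.

Lemma const_scalable : scalable_for *:%R (const : free_alg K -> F).
Proof. by move=> k a; apply: fpsP => -[|n] //=; rewrite scaler0. Qed.

(** * Straightening on the free algebra *)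

Lemma free_wordZ (k : K) (w : {fmonom 'I_2}) :
  k *: free_word w = monalg.mkmalgU w k.
Proof.
rewrite free_word.unlock; apply/monalg.malgP => v; rewrite monalg.mcoeffZ.
by rewrite (monalg.mcoeffU w) (monalg.mcoeffU w k) mulrnAr mulr1.
Qed.

Lemma free_alg_ind (P : free_alg K -> Prop) :
  P 0 -> (forall a b, P a -> P b -> P (a + b)) ->
  (forall (k : K) w, P (k *: free_word w)) -> forall a, P a.
Proof.
move=> P0 PD PU a; rewrite (monalg.monalgE a).
by elim/big_ind: _ => // w _; rewrite -free_wordZ.
Qed.

Definition free_straighten (a : free_alg K) : F :=
  monalg.mmap (in_alg F)
    (fun w : {fmonom 'I_2} => straighten (fX K) (fY K) r w) a.

HB.instance Definition _ := GRing.Additive.copy free_straighten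
  (monalg.mmap (in_alg F)
    (fun w : {fmonom 'I_2} => straighten (fX K) (fY K) r w)).

Lemma free_straightenZ (k : K) (w : {fmonom 'I_2}) :
  free_straighten (k *: free_word w) = k *: straighten (fX K) (fY K) r w.
Proof. by rewrite free_wordZ /free_straighten monalg.mmapU /= mulr_algl. Qed.

Lemma free_wordM (u v : {fmonom 'I_2}) :
  free_word u * free_word v = free_word (mmul u v) :> free_alg K.
Proof. by rewrite free_word.unlock [LHS]monalg.fgmulUU mulr1. Qed.

Lemma word_const (w : {fmonom 'I_2}) :
  word (fX K) (fY K) w = const (free_word w).
Proof.
case: w => w; elim: w => [|i w IHw].
  by rewrite /word big_nil -fmoneE free_word.unlock.
have uwE : FMonom (i :: w) = mmul (fmu i) (FMonom w).
  by rewrite /mmul /= fmmulE fmuE.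
rewrite [in RHS]uwE -free_wordM constM -IHw /word big_cons /letter; congr (_ * _).
rewrite free_word.unlock.
case: eqP => [-> //|/eqP i0]; congr (const (<< fmu _ >>)).
by apply/val_inj; case: i i0 {uwE} => -[|[|]].
Qed.

Definition free_commutator : free_alg K :=
  free_word (fmu ord0) * free_word (fmu ord_max) -
    free_word (fmu ord_max) * free_word (fmu ord0).

Lemma relation_commutator : fX K * fY K - fY K * fX K = r + feps K * Cxy.
Proof. by rewrite subrK. Qed.

Lemma coef0_mul (f g : F) : coef (f * g) 0 = coef f 0 * coef g 0.
Proof. by rewrite coef_mul big_ord1. Qed.

Lemma coef0_relation : coef r 0 = free_commutator.
Proof.
by rewrite /free_commutator free_word.unlock /= coef_epsM !coef0_mul oppr0 addr0.
Qed.

Lemma free_commutator_word (u v : {fmonom 'I_2}) :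
  free_word u * free_commutator * free_word v =
    free_word (FMonom (u ++ [:: ord0, ord_max & v])) -
    free_word (FMonom (u ++ [:: ord_max, ord0 & v])) :> free_alg K.
Proof.
rewrite sandwich_commutator !free_wordM.
by congr (free_word _ - free_word _); rewrite /mmul /= !fmmulE !fmuE /= -!catA.
Qed.

Lemma free_straighten_word (u v : {fmonom 'I_2}) :
  free_straighten (free_word u * free_commutator * free_word v) -
    const (free_word u) * r * const (free_word v) \in eI.
Proof.
have fsw w : free_straighten (free_word w) = straighten (fX K) (fY K) r w.
  by have := free_straightenZ 1 w; rewrite !scale1r.
have fsB a b : free_straighten (a - b) = free_straighten a - free_straighten b.
  exact: raddfB.
rewrite free_commutator_word fsB !fsw -(word_const u) -(word_const v).
exact: (straighten_swap eps_central relation_commutator).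
Qed.

Lemma free_straighten_commutator a b :
  free_straighten (a * free_commutator * b) - const a * r * const b \in eI.
Proof.
apply: (sandwich_defect (free_alg_ind) (free_straightenZ)
  const_scalable _ free_straighten_word).
by move=> f g; apply: central_idealMl; exact: eps_central.
Qed.

(** * Torsion-freeness of the quotient *)

Lemma relation_const_sandwich (f g : F) :
  f * r * g - const (coef f 0) * r * const (coef g 0) \in eI.
Proof.
have := central_ideal_sandwich r eps_central
  (const (coef f 0)) (Fps (fun n => coef f n.+1))
  (const (coef g 0)) (Fps (fun n => coef g n.+1)).
by rewrite -(const_shift f) -(const_shift g).
Qed.

Lemma ideal_eps_regular (f : F) : feps K * f \in I -> f \in I.
Proof.
case/ideal_genP=> s fs.
suff /central_idealP[g Ig /eps_regular -> //] : feps K * f \in eI.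
(* This sum is the constant coefficient of [feps K * f], since [r] reduces to the commutator modulo
   eps. *)
have s0 : \sum_(p <- s) coef p.1 0 * free_commutator * coef p.2 0 = 0.
  transitivity (coef (\sum_(p <- s) p.1 * r * p.2) 0); last first.
    by rewrite -fs coef_epsM.
  elim: s {fs} => [|p s IHs]; first by rewrite !big_nil.
  by rewrite !big_cons [RHS]/= !coef0_mul coef0_relation IHs.
have -> : feps K * f = \sum_(p <- s) (p.1 * r * p.2 -
    free_straighten (coef p.1 0 * free_commutator * coef p.2 0)).
  by rewrite sumrB -(raddf_sum free_straighten) s0 raddf0 subr0.
apply: rpred_sum => -[p q] _ /=.
(* Modulo [eI], both terms equal the sandwich of [r] between the constant terms of [p] and [q]. *)
have := rpredB (relation_const_sandwich p q)
  (free_straighten_commutator (coef p 0) (coef q 0)).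
by rewrite opprB subrKA.
Qed.

(** * The projection of the quotient onto commutative polynomials *)

Definition quot_pi (q : quot_alg Cxy) : {mpoly K[2]} := piF (repr q).

(** The choice of representative is harmless because [piF] kills the ideal. *)
Lemma quot_piE (f : F) : quot_pi (psiF Cxy f) = piF f.
Proof. by have := piF_ideal (repr_psiF Cxy f); rewrite raddfB => /subr0_eq. Qed.

Lemma quot_pi_zmod_morphism : zmod_morphism quot_pi.
Proof.
move=> p q; have [[f <-] [g <-]] := (psiF_surj p, psiF_surj q).
by rewrite -(raddfB (psiF Cxy)) !quot_piE raddfB.
Qed.
HB.instance Definition _ := GRing.isZmodMorphism.Build (quot_alg Cxy)
  {mpoly K[2]} quot_pi quot_pi_zmod_morphism.

Lemma quot_pi_monoid_morphism : monoid_morphism quot_pi.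
Proof.
split=> [|p q]; first by rewrite -(rmorph1 (psiF Cxy)) quot_piE rmorph1.
have [[f <-] [g <-]] := (psiF_surj p, psiF_surj q).
by rewrite -(rmorphM (psiF Cxy)) !quot_piE rmorphM.
Qed.
HB.instance Definition _ := GRing.isMonoidMorphism.Build (quot_alg Cxy)
  {mpoly K[2]} quot_pi quot_pi_monoid_morphism.

Lemma quot_pi_scalable : scalable quot_pi.
Proof.
by move=> k q; have [f <-] := psiF_surj q; rewrite -(psiF_scalable Cxy k f) !quot_piE linearZ.
Qed.
HB.instance Definition _ := GRing.isScalable.Build K (quot_alg Cxy)
  {mpoly K[2]} *:%R quot_pi quot_pi_scalable.

Lemma piF_surj (p : {mpoly K[2]}) : exists f, piF f = p.
Proof.
elim/mpolyind: p => [|k m p _ _ [f <-]]; first by exists 0; rewrite raddf0.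
(* Each commutative monomial is lifted to the ordered one, with all [x] before all [y]. *)
exists (k *: (fX K ^+ m ord0 * fY K ^+ m ord_max) + f).
rewrite raddfD /= piF_scalable rmorphM !rmorphXn /= piF_X piF_Y.
congr (_ *: _ + _).
rewrite [RHS]mpolyXE_id big_ord_recl big_ord1; congr (_ * 'X__ ^+ m _);
  exact: val_inj.
Qed.

Lemma quot_deformation_quantization : deformation_quantization (psiF Cxy).
Proof.
split=> [|q]; last first.
  have [f <-] := psiF_surj q; rewrite -rmorphM -(raddf0 (psiF Cxy)).
  by move/psiF_eq; rewrite subr0 => /ideal_eps_regular If; apply/psiF_eq; rewrite subr0.
exists quot_pi; split=> [p||||f] /=; last exact: quot_piE.
- by have [f <-] := piF_surj p; exists (psiF Cxy f); exact: quot_piE.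
- by rewrite (quot_piE (feps K)) piF_eps.
- by rewrite (quot_piE (fX K)) piF_X.
- by rewrite (quot_piE (fY K)) piF_Y.
Qed.

End Deformation.

Theorem corollary2 (R : realType) (Cxy : formal_alg R[i]) :
  deformation_quantization (psiF Cxy).
Proof. exact: quot_deformation_quantization. Qed.
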